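(* Suppose $\Omega\subset\mathbb R^n$, $n\ge 2$, is open and locally connected on the boundary. Let $\delta>0$ and let $f\colon\Omega\to\mathbb R^n$ be a $\delta$-monotone map that is bounded on bounded subsets of $\Omega$. Then $f$ has a continuous extension to $\overline{\Omega}$, which is also $\delta$-monotone.
   Context: For a set $A\subset\mathbb R^n$ and $\delta>0$, a map $f\colon A\to\mathbb R^n$ is $\delta$-monotone if $\langle f(x)-f(y),x-y\rangle\ge\delta\,|f(x)-f(y)|\,|x-y|$ for all $x,y\in A$, where $\langle\cdot,\cdot\rangle$ and $|\cdot|$ are the Euclidean inner product and norm. An open set $\Omega\subset\mathbb R^n$ is locally connected on the boundary if for every $b\in\partial\Omega$ and every $r>0$ there exists an open set $U$ such that $b\in U\subset B(b,r)$ and $U\cap\Omega$ is connected. Here $B(b,r)$ is the open ball of center $b$ and radius $r$. *)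

(* Defs.v *)
From HB Require Import structures.
From mathcomp Require Import all_boot all_order all_algebra.
From mathcomp Require Import all_classical all_reals all_analysis.
Import Order.TTheory GRing.Theory Num.Theory numFieldNormedType.Exports.

Set Implicit Arguments.
Unset Strict Implicit.
Unset Printing Implicit Defensive.

Local Open Scope classical_set_scope.
Local Open Scope ring_scope.

(* R^n is 'rV[R]_n.  The norm `|x| of the library on 'rV[R]_n is the maximum
   norm, so the Euclidean structure is introduced here; the topology of
   'rV[R]_n (open, closure, connected, continuous) is the product topology,
   which is the one induced by the Euclidean norm. *)
Definition edot (R : realType) (n : nat) (x y : 'rV[R]_n) : R :=
  \sum_(i < n) x ord0 i * y ord0 i.

Definition enorm (R : realType) (n : nat) (x : 'rV[R]_n) : R :=
  Num.sqrt (edot x x).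

Definition eball (R : realType) (n : nat) (b : 'rV[R]_n) (r : R) :
  set 'rV[R]_n := [set x | enorm (x - b) < r].

Definition ebounded (R : realType) (n : nat) (A : set 'rV[R]_n) : Prop :=
  exists M : R, forall x, A x -> enorm x <= M.

(* A map A -> R^n is represented by a total function of which only the values
   on A are constrained. *)
Definition delta_monotone (R : realType) (n : nat) (delta : R)
    (A : set 'rV[R]_n) (f : 'rV[R]_n -> 'rV[R]_n) : Prop :=
  forall x y, A x -> A y ->
    delta * enorm (f x - f y) * enorm (x - y) <= edot (f x - f y) (x - y).

Definition bounded_on_bounded (R : realType) (n : nat)
    (A : set 'rV[R]_n) (f : 'rV[R]_n -> 'rV[R]_n) : Prop :=
  forall B, B `<=` A -> ebounded B -> ebounded (f @` B).

Definition boundary (T : topologicalType) (A : set T) : set T :=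
  closure A `\` interior A.

Definition locally_connected_on_boundary (R : realType) (n : nat)
    (Omega : set 'rV[R]_n) : Prop :=
  forall b, boundary Omega b -> forall r : R, 0 < r ->
    exists U : set 'rV[R]_n,
      [/\ open U, U b, U `<=` eball b r & connected (U `&` Omega)].

(* Main.v *)
Require Import Defs.
From mathcomp Require Import all_boot all_order all_algebra.
From mathcomp Require Import all_classical all_reals all_analysis.
From mathcomp Require Import ring lra.
Import Order.TTheory GRing.Theory Num.Theory numFieldNormedType.Exports.
Local Open Scope classical_set_scope.
Local Open Scope ring_scope.

(* Let [K(t)] be the cone of vectors [p] with [<p, t> >= delta |p|].  If [f] has
   limits [w1], [w2] along two families tending to [b] with limiting directions
   [t1], [t2] seen from [b], then letting one family converge before the other
   gives [w1 - w2] in both [K(t1)] and [K(-t2)]; these cones meet only in [0] when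
   [t1] and [t2] are close.  So near [b] the map [f] is almost constant on each of
   finitely many cones of directions, and therefore has small oscillation on
   connected sets that avoid [b].  At a boundary point such sets come from local
   connectedness and the limit exists.  At an interior point a punctured ball is
   connected because [n >= 2], and monotonicity forces the limit to be [f b]. *)

(** * Euclidean inner product and norm, compared with the maximum norm *)

Section Euclidean.
Set Implicit Arguments.
Unset Strict Implicit.
Context {R : realType} {n : nat}.
Implicit Types (x y z : 'rV[R]_n) (c : R).

Lemma normr_coord_le x i : `|x ord0 i| <= `|x|.
Proof.
rewrite [leRHS]/Num.Def.normr /= mx_normrE.
by apply/bigmax_geP; right => /=; exists (ord0, i).
Qed.

Lemma normr_le_coord x c : 0 <= c -> (forall i, `|x ord0 i| <= c) -> `|x| <= c.
Proof.
move=> c0 xc; rewrite [leLHS]/Num.Def.normr /= mx_normrE.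
by apply: bigmax_le => // -[i j] _ /=; rewrite (ord1 i).
Qed.

Lemma edotC x y : edot x y = edot y x.
Proof. by apply: eq_bigr => i _; rewrite mulrC. Qed.

Lemma edotDl x y z : edot (x + y) z = edot x z + edot y z.
Proof. by rewrite /edot -big_split; apply: eq_bigr => i _; rewrite mxE mulrDl. Qed.

Lemma edotZl c x y : edot (c *: x) y = c * edot x y.
Proof. by rewrite /edot mulr_sumr; apply: eq_bigr => i _; rewrite mxE mulrA. Qed.

Lemma edotDr x y z : edot x (y + z) = edot x y + edot x z.
Proof. by rewrite edotC edotDl edotC [edot z x]edotC. Qed.

Lemma edotZr c x y : edot x (c *: y) = c * edot x y.
Proof. by rewrite edotC edotZl edotC. Qed.

Lemma edotNl x y : edot (- x) y = - edot x y.
Proof. by rewrite -scaleN1r edotZl mulN1r. Qed.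

Lemma edotNr x y : edot x (- y) = - edot x y.
Proof. by rewrite edotC edotNl edotC. Qed.

Lemma edot_ge0 x : 0 <= edot x x.
Proof. by apply: sumr_ge0 => i _; rewrite -expr2 sqr_ge0. Qed.

(** A crude substitute for Cauchy-Schwarz: each of the [n] products of coordinates is at most the
    product of the maximum norms. *)
Lemma edot_le x y : edot x y <= n%:R * `|x| * `|y|.
Proof.
apply: (@le_trans _ _ (\sum_(i < n) `|x| * `|y|)); last first.
  by rewrite sumr_const card_ord -mulrA mulr_natl.
apply: ler_sum => i _; apply: (le_trans (ler_norm _)).
by rewrite normrM ler_pM // normr_coord_le.
Qed.

Lemma enorm_ge0 x : 0 <= enorm x.
Proof. exact: sqrtr_ge0. Qed.

Lemma enormZ c x : enorm (c *: x) = `|c| * enorm x.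
Proof.
by rewrite /enorm edotZl edotZr mulrA -expr2 sqrtrM ?sqr_ge0// sqrtr_sqr.
Qed.

Lemma enormN x : enorm (- x) = enorm x.
Proof. by rewrite -scaleN1r enormZ normrN1 mul1r. Qed.

Lemma normr_le_enorm x : `|x| <= enorm x.
Proof.
apply: normr_le_coord => [|i]; first exact: enorm_ge0.
rewrite -sqrtr_sqr ler_sqrt ?edot_ge0// /edot (bigD1 i)//= -expr2 lerDl.
by apply: sumr_ge0 => j _; rewrite -expr2 sqr_ge0.
Qed.

Lemma enorm_le x : enorm x <= n%:R * `|x|.
Proof.
have nx0 : 0 <= n%:R * `|x| by rewrite mulr_ge0.
rewrite -(ger0_norm nx0) -sqrtr_sqr ler_sqrt ?sqr_ge0//.
apply: (le_trans (edot_le x x)); rewrite exprMn expr2 -mulrA -expr2.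
rewrite ler_wpM2r ?sqr_ge0// -natrM ler_nat.
by case: (n) => // m; rewrite leq_pmulr.
Qed.

Lemma enorm_gt0 x : x != 0 -> 0 < enorm x.
Proof. by move=> x0; rewrite (lt_le_trans _ (normr_le_enorm x))// normr_gt0. Qed.

Lemma cvg_edot {T} {F : set_system T} {FF : Filter F} (u v : T -> 'rV[R]_n) x y :
  u @ F --> x -> v @ F --> y -> edot (u t) (v t) @[t --> F] --> edot x y.
Proof.
move=> ux vy; rewrite /edot.
apply: cvg_big => [|i _].
  exact: add_continuous.
have cvg_coord (w : T -> 'rV[R]_n) z : w @ F --> z ->
    w t ord0 i @[t --> F] --> z ord0 i.
  move=> wz; apply: (cvg_comp w (fun M : 'rV[R]_n => M ord0 i) wz).
  exact: coord_continuous.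
by apply: cvgM; exact: cvg_coord.
Qed.

Lemma cvg_enorm {T} {F : set_system T} {FF : Filter F} (u : T -> 'rV[R]_n) x :
  u @ F --> x -> enorm (u t) @[t --> F] --> enorm x.
Proof.
move=> ux; apply: (@cvg_comp _ _ _ (fun t => edot (u t) (u t)) Num.sqrt).
  exact: (cvg_edot ux ux).
exact: sqrt_continuous.
Qed.

End Euclidean.

(** * Ultrafilters and passage to the limit in inequalities *)

Lemma ultra_fmap T U (u : T -> U) (F : set_system T) :
  UltraFilter F -> UltraFilter (u @ F).
Proof.
move=> UF; split; first exact: fmap_proper_filter.
move=> G GP FG; apply/seteqP; split=> [B GB|//].
(* The ultrafilter [F] contains the preimage of [B] or its complement; in the second case [G] would
   contain both [B] and its complement. *)
have [//|FnB] := in_ultra_setVsetC (u @^-1` B) UF.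
have GnB : G (~` B) by exact: FG.
have := filterI GB GnB; rewrite setICr => G0.
by case: (@filter_not_empty _ G _ (G0 _)).
Qed.

(* [ler_cvg_to] asks for a topology on the domain of the functions. *)
Lemma ler_cvg_filter (R : realFieldType) T (F : set_system T) (u v : T -> R)
    (a b : R) : ProperFilter F -> u @ F --> a -> v @ F --> b ->
  (\forall t \near F, u t <= v t) -> a <= b.
Proof.
move=> FF ua vb uv; rewrite -subr_ge0.
have vu0 : \forall t \near F, 0 <= (v - u) t.
  by apply: filterS uv => t; rewrite subr_ge0.
exact: (closed_cvg _ (@closed_ge R 0) vu0 _ (cvgB vb ua)).
Qed.

(** * Limit values and limit directions of a monotone map at a point *)

Section LocalEstimates.
Set Implicit Arguments.
Unset Strict Implicit.
Context {R : realType} {n : nat}.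
Implicit Types (x y p d w : 'rV[R]_n).

(** Closed balls are compact, and an ultrafilter on a compact set converges. This replaces the
    extraction of convergent subsequences. *)
Lemma bounded_ultra_cvg T (F : set_system T) (u : T -> 'rV[R]_n) (M : R) :
  UltraFilter F -> (\forall t \near F, `|u t| <= M) ->
  exists l : 'rV[R]_n, u @ F --> l.
Proof.
move=> UF uM.
have : compact (closed_ball_ Num.norm (0 : 'rV[R]_n) M).
  apply: bounded_closed_compact; last exact: closed_closed_ball_.
  exists M; split; first exact: num_real.
  by move=> c Mc x; rewrite /closed_ball_/= sub0r normrN => /le_trans; apply; exact: ltW.
have {}uM : (u @ F) (closed_ball_ Num.norm (0 : 'rV[R]_n) M).
  by apply: filterS uM => t; rewrite /closed_ball_/= sub0r normrN.
rewrite compact_ultra => /(_ (u @ F) (ultra_fmap u UF) uM) [l [_ ul]].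
by exists l.
Qed.

(** The inequality of [delta_monotone] with free vectors in place of the two increments, so that it
    can pass to limits. *)
Definition in_cone (delta : R) p d := delta * enorm p * enorm d <= edot p d.

Lemma cvg_in_cone T (F : set_system T) (u v : T -> 'rV[R]_n) delta p d :
  ProperFilter F -> u @ F --> p -> v @ F --> d ->
  (\forall t \near F, in_cone delta (u t) (v t)) -> in_cone delta p d.
Proof.
move=> FF up vd; apply: ler_cvg_filter; last exact: (cvg_edot up vd).
apply: cvgM; last exact: cvg_enorm.
by apply: cvgM; [exact: cvg_cst|exact: cvg_enorm].
Qed.

Definition direction (b x : 'rV[R]_n) := (enorm (x - b))^-1 *: (x - b).

Lemma enorm_direction b x : x != b -> enorm (direction b x) = 1.
Proof.
rewrite -subr_eq0 => /enorm_gt0 xb.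
by rewrite enormZ ger0_norm ?invr_ge0 ?enorm_ge0// mulVf// gt_eqF.
Qed.

Lemma in_cone_direction delta b p x :
  x != b -> in_cone delta p (x - b) -> delta * enorm p <= edot p (direction b x).
Proof.
rewrite -subr_eq0 => /enorm_gt0 xb.
by move=> px; rewrite /direction edotZr [leRHS]mulrC ler_pdivlMr.
Qed.

Lemma cvg_direction b x : x != b -> direction b y @[y --> x] --> direction b x.
Proof.
rewrite -subr_eq0 => /enorm_gt0 xb.
have yb : y - b @[y --> x] --> x - b.
  exact: (cvgB (@cvg_id _ (nbhs x)) (cvg_cst b)).
have exb : enorm (x - b) != 0 by rewrite gt_eqF.
exact: (cvgZ (cvgV exb (cvg_enorm yb)) yb).
Qed.

Variables (delta : R) (A : set 'rV[R]_n) (f : 'rV[R]_n -> 'rV[R]_n).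
Variables (b : 'rV[R]_n) (M : R).
Hypotheses (delta_gt0 : 0 < delta) (f_mono : delta_monotone delta A f).
Hypothesis (f_bdd : \forall x \near b, A x -> `|f x| <= M).

(** The inner of the two limits: [x] stays fixed while the other point tends to [b], and the cone
    condition is closed. *)
Lemma in_cone_cluster T (F : set_system T) (u : T -> 'rV[R]_n) w x :
  ProperFilter F -> u @ F --> b -> f \o u @ F --> w ->
  (\forall t \near F, A (u t)) -> A x -> in_cone delta (f x - w) (x - b).
Proof.
move=> FF ub fuw Au Ax.
apply: (@cvg_in_cone _ F (fun t => f x - f (u t)) (fun t => x - u t)).
- exact: (cvgB (cvg_cst (f x)) fuw).
- exact: (cvgB (cvg_cst x) ub).
- by apply: filterS Au => t Aut; exact: f_mono.
Qed.

(** Otherwise an ultrafilter of bad pairs has limit values [w1], [w2] and limit directions [t1],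
    [t2]. The two cone conditions add up to [2 delta |w1 - w2| <= <w1 - w2, t1 - t2>], whose right
    side is at most [delta |w1 - w2|]; so [w1 = w2], although the values stay [e] apart. *)
Lemma close_directions_close_values e : 0 < e ->
  \forall p \near (b, b), A p.1 -> A p.2 -> p.1 != b -> p.2 != b ->
    n%:R * `|direction b p.1 - direction b p.2| <= delta ->
    `|f p.1 - f p.2| < e.
Proof.
move=> e0; apply: contrapT => nQ.
set Q := (X in ~ (\forall p \near _, X p)) in nQ.
have clQ : closure (~` Q) (b, b).
  move=> B bB; apply: contrapT => /nonemptyPn QB0; apply: nQ.
  apply: filterS bB => p Bp; apply: contrapT => nQp.
  by have : (~` Q `&` B) p by []; rewrite QB0.
have [G [UG FG]] := ultraFilterLemma (within_nbhs_proper clQ).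
have GQ : \forall p \near G, ~ Q p by apply: FG; exact: withinT.
have Gb : G --> (b, b) by move=> B bB; apply: FG; exact: (@cvg_within _ _ _ (~` Q) _ bB).
have [Gb1 Gb2] : fst @ G --> b /\ snd @ G --> b.
  split=> B bB; apply: Gb; first exact: (@cvg_fst _ _ (nbhs b) (nbhs b)).
  exact: (@cvg_snd _ _ (nbhs b) (nbhs b)).
have GA : \forall p \near G, [/\ A p.1, A p.2, p.1 != b, p.2 != b &
    n%:R * `|direction b p.1 - direction b p.2| <= delta /\ e <= `|f p.1 - f p.2|].
  apply: filterS GQ => p; rewrite /Q.
  move=> /not_implyP[Ap1] /not_implyP[Ap2] /not_implyP[p1b] /not_implyP[p2b].
  by move=> /not_implyP[pd] /negP; rewrite -leNgt.
have GA1 : \forall p \near G, A p.1 by apply: filterS GA => p [].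
have GA2 : \forall p \near G, A p.2 by apply: filterS GA => p [].
have Gd1 : \forall p \near G, p.1 != b by apply: filterS GA => p [].
have Gd2 : \forall p \near G, p.2 != b by apply: filterS GA => p [].
have value_cvg (u : 'rV[R]_n * 'rV[R]_n -> 'rV[R]_n) : u @ G --> b ->
    (\forall p \near G, A (u p)) -> exists w : 'rV[R]_n, f \o u @ G --> w.
  move=> ub Au; apply: (@bounded_ultra_cvg _ _ _ M) => //.
  by apply: filterS2 Au (ub _ f_bdd) => p Ap; exact.
have direction_cvg (u : 'rV[R]_n * 'rV[R]_n -> 'rV[R]_n) :
    (\forall p \near G, u p != b) -> exists t : 'rV[R]_n, direction b \o u @ G --> t.
  move=> ub; apply: (@bounded_ultra_cvg _ _ _ 1).
  by apply: filterS ub => p /enorm_direction <-; exact: normr_le_enorm.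
(* The outer limit: [u p] takes the place of [x] and tends to [b]; dividing the cone condition by
   [enorm (u p - b)] leaves the limiting direction [t]. *)
have cone_lim (u : 'rV[R]_n * 'rV[R]_n -> 'rV[R]_n)
    (w w' t : 'rV[R]_n) :
    (\forall p \near G, A (u p)) -> (\forall p \near G, u p != b) ->
    f \o u @ G --> w -> direction b \o u @ G --> t ->
    (forall x, A x -> in_cone delta (f x - w') (x - b)) ->
    delta * enorm (w - w') <= edot (w - w') t.
  move=> Au ub fuw ut cw'.
  have fuw' : f (u p) - w' @[p --> G] --> w - w'.
    exact: (cvgB fuw (cvg_cst w')).
  apply: (@ler_cvg_filter _ _ G _ _ _ _ _
    (cvgM (cvg_cst delta) (cvg_enorm fuw')) (cvg_edot fuw' ut)).
  apply: filterS2 Au ub => p Ap pb; apply: in_cone_direction => //.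
  exact: cw'.
have [w1 fw1] := value_cvg _ Gb1 GA1.
have [w2 fw2] := value_cvg _ Gb2 GA2.
have [t1 dt1] := direction_cvg _ Gd1.
have [t2 dt2] := direction_cvg _ Gd2.
have le1 : delta * enorm (w1 - w2) <= edot (w1 - w2) t1.
  apply: (cone_lim _ _ _ _ GA1 Gd1 fw1 dt1) => x Ax.
  exact: (in_cone_cluster _ Gb2 fw2 GA2).
have le2 : delta * enorm (w2 - w1) <= edot (w2 - w1) t2.
  apply: (cone_lim _ _ _ _ GA2 Gd2 fw2 dt2) => x Ax.
  exact: (in_cone_cluster _ Gb1 fw1 GA1).
have et : n%:R * `|t1 - t2| <= delta.
  have dt : direction b p.1 - direction b p.2 @[p --> G] --> t1 - t2.
    exact: (cvgB dt1 dt2).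
  apply: (@ler_cvg_filter _ _ G _ _ _ _ _
    (cvgM (cvg_cst (n%:R : R)) (cvg_norm dt)) (cvg_cst delta)).
  by apply: filterS GA => p [_ _ _ _ []].
have ew : e <= `|w1 - w2|.
  have fw : f p.1 - f p.2 @[p --> G] --> w1 - w2.
    exact: (cvgB fw1 fw2).
  apply: (@ler_cvg_filter _ _ G _ _ _ _ _ (cvg_cst (e : R)) (cvg_norm fw)).
  by apply: filterS GA => p [_ _ _ _ []].
have ew' := lt_le_trans (lt_le_trans e0 ew) (normr_le_enorm _).
have et12 : edot (w1 - w2) (t1 - t2) <= delta * enorm (w1 - w2).
  by apply: (le_trans (edot_le _ _)); rewrite mulrAC ler_pM ?normr_le_enorm//.
move: le1 le2 et12; rewrite -(opprB w1 w2) enormN edotNl edotDr edotNr.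
by have := mulr_gt0 delta_gt0 ew'; lra.
Qed.

End LocalEstimates.

(** * Connectedness through locally constant boolean functions *)

Section LocallyConstant.
Set Implicit Arguments.
Unset Strict Implicit.

Definition locally_constant_on (T : topologicalType) (S : set T)
    (P : T -> bool) :=
  forall x, S x -> \forall y \near x, S y -> P y = P x.

(** This form of connectedness can be checked by chaining segments, and it applies directly to the
    sublevel set in the oscillation estimate. *)
Definition preconnected (T : topologicalType) (S : set T) :=
  forall P, locally_constant_on S P -> forall x y, S x -> S y -> P x = P y.

(** The fibre [B] of [P] through [y] is open and closed in [S]: [P] is constant on [S] near each
    point, so both witnesses come from interiors. *)
Lemma connected_preconnected (T : topologicalType) (S : set T) :
  connected S -> preconnected S.
Proof.
move=> Sc P Plc x y Sx Sy.
pose B := [set z | S z /\ P z = P y].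
suff BS : B = S by have : S x by []; rewrite -BS => -[].
apply: Sc; first by exists y.
- exists (interior [set z | S z -> P z = P y]); first exact: open_interior.
  apply/seteqP; split=> z /=.
    by move=> [Sz Pz]; split=> //; apply: filterS (Plc _ Sz) => t /[apply] ->.
  by move=> [Sz /nbhs_singleton]; split=> //; auto.
- exists (~` interior [set z | S z -> P z != P y]).
    by apply: open_closedC; exact: open_interior.
  apply/seteqP; split=> z /=.
    by move=> [Sz Pz]; split=> // /nbhs_singleton/(_ Sz); rewrite Pz eqxx.
  move=> [Sz nPz]; split=> //; apply/eqP; apply: contra_notT nPz => Pz.
  by apply: filterS (Plc _ Sz) => t /[apply] ->.
Qed.

(** Pull [P] back to the connected interval [[0, 1]] along the affine parametrisation. *)
Lemma locally_constant_segment (R : realType) (V : normedModType R)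
    (S : set V) (P : V -> bool) (x y : V) :
  locally_constant_on S P ->
  (forall t : R, 0 <= t <= 1 -> S (x + t *: (y - x))) -> P x = P y.
Proof.
move=> Plc xyS; pose u (t : R) := x + t *: (y - x).
have uc : continuous u.
  move=> t; apply: cvgD; first exact: cvg_cst.
  by apply: cvgZr_tmp; exact: cvg_id.
have Pu : locally_constant_on (`[0, 1]%classic : set R) (P \o u).
  move=> t /= t01; have Su : S (u t) by apply: xyS; move: t01; rewrite in_itv.
  have Pus : \forall s \near t, S (u s) -> P (u s) = P (u t).
    exact: (uc t _ (Plc _ Su)).
  apply: filterS Pus => s /= us s01.
  by apply: us; apply: xyS; move: s01; rewrite in_itv.
have := connected_preconnected (@segment_connected R 0 1) Pu (x := 0) (y := 1).
rewrite /u /= scale0r addr0 scale1r addrC subrK; apply; rewrite in_itv/= ?lexx ?ler01//.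
Qed.

(** Some coordinate [i] of [x - b] is nonzero. If it is positive, [x] and [p] lie on one side of a
    hyperplane. If it is negative, the path goes through [q i], on the side of [x] in coordinate [i]
    and on the side of [p] in another coordinate [j], which exists as [n >= 2]. *)
Lemma preconnected_punctured_ball (R : realType) (n : nat) (b : 'rV[R]_n) (r : R) :
  (2 <= n)%N -> 0 < r -> preconnected [set x | x != b /\ `|x - b| < r].
Proof.
move=> n2 r0 P Plc.
(* All points on the same side of a hyperplane [x i = b i] are joined by segments. *)
have side (s : R) i x y : 0 < s * (x - b) ord0 i -> 0 < s * (y - b) ord0 i ->
    `|x - b| < r -> `|y - b| < r -> P x = P y.
  move=> xi yi xr yr; apply: (locally_constant_segment Plc) => t /andP[t0 t1].
  have -> : x + t *: (y - x) = b + ((1 - t) *: (x - b) + t *: (y - b)).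
    by apply/rowP => j; rewrite !mxE; ring.
  set z := _ + t *: _.
  have zi : 0 < s * z ord0 i.
    rewrite /z mxE [X in X + _]mxE [X in _ + X]mxE.
    have [->|t0'] := eqVneq t 0; first by rewrite subr0 mul0r addr0 mul1r.
    have tp : 0 < t by rewrite lt0r t0'.
    have := mulr_gt0 tp yi; have : 0 <= (1 - t) * (s * (x - b) ord0 i).
      by rewrite mulr_ge0 ?subr_ge0// ltW.
    by lra.
  split; rewrite addrC.
    apply: contraTneq zi => /(canRL (addrK _)); rewrite subrr => ->.
    by rewrite mxE mulr0 ltxx.
  rewrite addKr; apply: (le_lt_trans (ler_normD _ _)).
  rewrite !normrZ !ger0_norm ?subr_ge0//.
  have [t1'|t1'] := ltP t 1.
    have : (1 - t) * `|x - b| < (1 - t) * r by rewrite ltr_pM2l// subr_gt0.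
    have : t * `|y - b| <= t * r by rewrite ler_wpM2l// ltW.
    by lra.
  have -> : t = 1 by apply/eqP; rewrite eq_le t1.
  by rewrite subrr mul0r add0r mul1r.
(* All coordinates of [p - b] equal [r / 2]; in [q i - b] the sign of coordinate [i] is reversed. *)
pose q i : 'rV[R]_n := b + \row_j (if j == i then - (r / 2) else r / 2).
pose p : 'rV[R]_n := b + const_mx (r / 2).
have r2 : 0 < r / 2 by rewrite divr_gt0.
have pr : `|p - b| < r.
  apply: (@le_lt_trans _ _ (r / 2)); last by lra.
  apply: normr_le_coord => [|j]; first exact: ltW.
  by rewrite addrC addKr mxE ger0_norm// ltW.
have qr i : `|q i - b| < r.
  apply: (@le_lt_trans _ _ (r / 2)); last by lra.
  apply: normr_le_coord => [|j]; first exact: ltW.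
  by rewrite addrC addKr mxE; case: ifP => _; rewrite ?normrN ger0_norm// ltW.
suff xp x : x != b -> `|x - b| < r -> P x = P p.
  by move=> x y /= [xb xr] [yb yr]; rewrite !xp.
move=> xb xr.
have [i xi] : exists i, (x - b) ord0 i != 0.
  apply/existsP; apply: contraNT xb; rewrite negb_exists => /forallP xb0.
  by rewrite -subr_eq0; apply/eqP/rowP => i; rewrite [RHS]mxE; apply/eqP; have := xb0 i; rewrite negbK.
have [xi0|xi0] := ltP 0 ((x - b) ord0 i).
  apply: (side 1 i) => //; rewrite mul1r// addrC addKr mxE//.
have [j ji] : exists j : 'I_n, j != i.
  have [i0|i0] := eqVneq (i : nat) 0%N.
    by exists (Ordinal n2); rewrite -val_eqE /= i0.
  by exists (Ordinal (ltnW n2)); rewrite -val_eqE /= eq_sym.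
transitivity (P (q i)).
  apply: (side (-1) i) => //; rewrite mulN1r oppr_gt0; first by rewrite lt_neqAle xi.
  by rewrite addrC addKr mxE eqxx oppr_lt0.
by apply: (side 1 j) => //; rewrite mul1r addrC addKr mxE// (negbTE ji).
Qed.

End LocallyConstant.

(** * Oscillation on connected sets near a point *)

Section Oscillation.
Set Implicit Arguments.
Unset Strict Implicit.
Context {R : realType} {n : nat}.
Implicit Types (x y p d w : 'rV[R]_n).

(* Grid cells of mesh [1 / K] on the unit sphere. *)
Definition cell (K : nat) (b x : 'rV[R]_n) : {ffun 'I_n -> 'I_K.*2.+1} :=
  [ffun i => inord (Num.truncn (K%:R * (1 + direction b x ord0 i)))].

(** Nonnegative numbers with the same truncation differ by less than 1, and in the maximum norm
    coordinates can be compared one by one. *)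
Lemma same_cell_close K b x y : x != b -> y != b -> cell K b x = cell K b y ->
  K%:R * `|direction b x - direction b y| <= 1.
Proof.
move=> xb yb cxy; have [->|K0] := posnP K; first by rewrite mul0r ler01.
rewrite mulrC -ler_pdivlMr ?ltr0n// mul1r.
apply: normr_le_coord => [|i]; first by rewrite invr_ge0.
have coord z : z != b -> `|direction b z ord0 i| <= 1.
  move=> zb; rewrite (le_trans (normr_coord_le _ _))//.
  by rewrite -(enorm_direction zb) normr_le_enorm.
have arg_bounds z : z != b ->
    0 <= K%:R * (1 + direction b z ord0 i) <= (K.*2)%:R.
  move=> /coord; rewrite ler_norml => /andP[d1 d2].
  by rewrite mulr_ge0//= -?muln2 ?natrM ?ler_wpM2l//; lra.
move/ffunP/(_ i) : cxy; rewrite !ffunE => /(congr1 val).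
(* The shift by 1 puts the scaled coordinate in [[0, 2K]], so its truncation is below [K.*2.+1] and
   [inord] does not fall back on its default. *)
have small z : z != b ->
    (Num.truncn (K%:R * (1 + direction b z ord0 i)) < K.*2.+1)%N.
  move=> /arg_bounds/andP[d0 d1].
  by rewrite ltnS truncn_le_nat (le_lt_trans d1)// ltr_nat.
rewrite /= !inordK ?small// => cxy.
have /andP[x0 _] := arg_bounds _ xb; have /andP[y0 _] := arg_bounds _ yb.
have := truncn_itv x0; have := truncn_itv y0; rewrite cxy -natr1.
set T := _%:R => /andP[ya yb'] /andP[xa xb'].
have -> : (direction b x - direction b y) ord0 i =
    (K%:R * (1 + direction b x ord0 i) - K%:R * (1 + direction b y ord0 i)) / K%:R.
  rewrite [LHS]mxE [X in _ + X = _]mxE; field.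
  by rewrite pnatr_eq0 -lt0n.
rewrite normrM normfV (@ger0_norm _ K%:R)// ler_piMl ?invr_ge0// ler_norml.
by apply/andP; split; lra.
Qed.

Variables (delta : R) (A : set 'rV[R]_n) (f : 'rV[R]_n -> 'rV[R]_n).
Variables (b : 'rV[R]_n) (M : R).
Hypotheses (delta_gt0 : 0 < delta) (f_mono : delta_monotone delta A f).
Hypothesis (f_bdd : \forall x \near b, A x -> `|f x| <= M).

(* There are boundedly many cells and [f] is almost constant on each, so the
   distances to a value [f y] leave a gap; that gap makes a sublevel set of the
   distance clopen in [S]. *)
Lemma small_oscillation e : 0 < e -> exists2 r : R, 0 < r &
  forall S, preconnected S -> S `<=` A -> S `<=` ball b r -> ~ S b ->
    forall x y, S x -> S y -> `|f x - f y| < e.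
Proof.
(* With [n / K <= delta], two points of one cell satisfy the hypothesis of
   [close_directions_close_values]. *)
move=> e0; pose K := (Num.truncn (n%:R / delta)).+1.
have Kn : n%:R <= delta * K%:R.
  by rewrite mulrC -ler_pdivrMr// ltW// truncnS_gt.
pose N := #|{ffun 'I_n -> 'I_K.*2.+1}|.
(* The bands from [2j h] to [(2j + 1) h], for [j <= N], are one more than the cells, and the last
   one ends exactly at [e]. *)
pose h := e / (N.*2.+1)%:R.
have h0 : 0 < h by rewrite divr_gt0.
have [r /= r0 rh] : exists2 r : R, 0 < r & forall x y, ball b r x -> ball b r y ->
    A x -> A y -> x != b -> y != b ->
    n%:R * `|direction b x - direction b y| <= delta -> `|f x - f y| < h.
  have /nbhs_ballP[r r0 rQ] := close_directions_close_values delta_gt0 f_mono f_bdd h0.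
  by exists r => // x y xr yr; apply: (rQ (x, y)).
exists r => // S Sconn SA Sr Sb x y Sx Sy.
have nb z : S z -> z != b by move=> Sz; apply/eqP => zb; rewrite zb in Sz.
have close z z' : S z -> S z' -> n%:R * `|direction b z - direction b z'| <= delta ->
    `|f z - f z'| < h.
  by move=> Sz Sz'; apply: rh; try exact: nb; try exact: Sr; exact: SA.
pose D z := `|f z - f y|.
have closeD z z' : S z -> S z' -> n%:R * `|direction b z - direction b z'| <= delta ->
    D z < D z' + h.
  move=> Sz Sz' zz'; have := close _ _ Sz Sz' zz'.
  have := ler_distD (f z') (f z) (f y); rewrite /D; lra.
(* Pigeonhole: if every band were hit, two hits would share a cell and their values of [D] would
   differ by less than [h]; but values in distinct bands are more than [h] apart. *)
have [j gap] : exists j : 'I_N.+1, forall z, S z ->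
    ~ (j.*2%:R * h <= D z < j.*2.+1%:R * h).
  apply: contrapT => nogap.
  have hit (j : 'I_N.+1) : {z | S z /\ j.*2%:R * h <= D z < j.*2.+1%:R * h}.
    apply: cid; apply: contrapT => nz; apply: nogap; exists j => z Sz jz.
    by apply: nz; exists z.
  have /injectivePn[j1 [j2 j12 cj]] :
      ~~ injectiveb (fun j => cell K b (sval (hit j))).
    apply/negP => /injectiveP/leq_card.
    by rewrite card_ord ltnn.
  have near12 i1 i2 : cell K b (sval (hit i1)) = cell K b (sval (hit i2)) ->
      (i1 < i2)%N -> False.
    move=> ci i12; case: (hit i1) (hit i2) ci => z1 [S1 /andP[_ D1]] [z2 [S2 /andP[D2 _]]] /= ci.
    have cl := same_cell_close (nb _ S1) (nb _ S2) ci.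
    have : D z2 < D z1 + h.
      apply: closeD => //; rewrite distrC (le_trans (ler_wpM2r _ Kn))// -mulrA.
      by rewrite ler_piMr// ltW.
    have : (i1.*2.+2)%:R * h <= i2.*2%:R * h.
      by rewrite (ler_wpM2r (ltW h0))// ler_nat -doubleS leq_double.
    by rewrite -natr1; lra.
  have : (j1 < j2)%N || (j2 < j1)%N by rewrite -neq_ltn.
  by case/orP => [|] /near12; apply.
pose P z := D z < j.*2%:R * h.
have gapP z : S z -> D z < j.*2.+1%:R * h -> P z.
  move=> Sz zj; rewrite /P ltNge; apply/negP => jz.
  by apply: (gap z Sz); rewrite jz.
(* Near [z] the directions are close, so [D] varies by less than [h], too little to cross the empty
   band. *)
have Plc : locally_constant_on S P.
  move=> z Sz.
  have zdir : \forall t \near z, n%:R * `|direction b t - direction b z| < delta.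
    have d0 : 0 < delta / n.+1%:R by rewrite divr_gt0.
    have zdist : \forall t \near z,
        `|direction b z - direction b t| < delta / n.+1%:R.
      by have /cvgrPdist_lt := cvg_direction (nb _ Sz); apply.
    apply: filterS zdist => t zt; rewrite distrC.
    apply: (@le_lt_trans _ _ (n.+1%:R * `|direction b z - direction b t|)).
      by rewrite ler_wpM2r// ler_nat.
    by rewrite mulrC -ltr_pdivlMr.
  apply: filterS zdir => t tz St; have {}tz := ltW tz.
  have zt : n%:R * `|direction b z - direction b t| <= delta by rewrite distrC.
  have := closeD _ _ St Sz tz; have := closeD _ _ Sz St zt => Dz Dt.
  by apply/idP/idP => Pz; apply: gapP => //; move: Pz; rewrite /P -natr1; lra.
(* [D y = 0] is below the top of the empty band, hence below the band itself; in particular this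
   band has [j > 0]. *)
have Py : P y.
  apply: gapP => //; rewrite /D subrr normr0 mulr_gt0//.
have : D x < j.*2%:R * h by rewrite -/(P x) (Sconn P Plc x y Sx Sy).
move=> /lt_le_trans; apply; rewrite /h mulrCA ler_piMr ?(ltW e0)//.
rewrite ler_pdivrMr// mul1r ler_nat.
by rewrite (leq_trans _ (leqnSn _))// leq_double -ltnS.
Qed.

End Oscillation.

(** * Extension to the closure *)

Section Extension.
Set Implicit Arguments.
Unset Strict Implicit.
Context {R : realType} {n : nat}.
Implicit Types (x y b : 'rV[R]_n).
Variables (delta : R) (Omega : set 'rV[R]_n) (f : 'rV[R]_n -> 'rV[R]_n).
Hypotheses (delta_gt0 : 0 < delta) (f_mono : delta_monotone delta Omega f).
Hypothesis f_bdd : bounded_on_bounded Omega f.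

Lemma locally_bounded b :
  exists M : R, \forall x \near b, Omega x -> `|f x| <= M.
Proof.
have [||M fM] := f_bdd (B := Omega `&` ball b 1); first exact: subIsetl.
  exists (n%:R * (`|b| + 1)) => x [_]; rewrite -ball_normE /= => bx.
  apply: (le_trans (enorm_le x)); rewrite ler_wpM2l//.
  by have := ler_normB b (b - x); rewrite opprB addrC subrK; lra.
exists M; have b1 : \forall x \near b, ball b 1 x by exact: nbhsx_ballx.
apply: filterS b1 => x bx Ox; apply: (le_trans (normr_le_enorm _)).
by apply: fM; exists x.
Qed.

(* The values at [x] and at its mirror image [2 b - x] are close, while their
   increments from [f b] lie in opposite cones. *)
Lemma continuous_interior b : (2 <= n)%N -> open Omega -> Omega b ->
  f @ b --> f b.
Proof.
move=> n2 oO Ob; apply/(@cvgrPdist_le _ _ _ (nbhs b)) => e e0.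
have [M fM] := locally_bounded b.
(* The divisor [n.+1] absorbs the factor [n] of [edot_le], and [delta] will cancel against the
   monotonicity constant. *)
have d0 : 0 < delta * e / n.+1%:R by rewrite divr_gt0// mulr_gt0.
have [r r0 osc] := small_oscillation delta_gt0 f_mono fM d0.
have /nbhs_ballP[s /= s0 sO] : nbhs b Omega by exact: open_nbhs_nbhs.
have m0 : 0 < Num.min r s by rewrite lt_min r0.
have mball x : `|x - b| < Num.min r s -> ball b r x /\ ball b s x.
  by rewrite -!ball_normE /= distrC lt_min => /andP.
have bm : \forall x \near b, ball b (Num.min r s) x by exact: nbhsx_ballx.
apply: filterS bm => x; rewrite -ball_normE /= distrC => xm.
have [->|xb] := eqVneq x b; first by rewrite subrr normr0 ltW.
pose x' := b - (x - b).
have x'E : x' - b = - (x - b) by rewrite /x' addrC addKr.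
have x'b : x' != b by rewrite -subr_eq0 x'E oppr_eq0 subr_eq0.
have x'm : `|x' - b| < Num.min r s by rewrite x'E normrN.
have xx' : `|f x - f x'| < delta * e / n.+1%:R.
  apply: (osc _ (@preconnected_punctured_ball R n b _ n2 m0)) => //=.
  - by move=> z [_ /mball[_ /sO]].
  - by move=> z [_ /mball[]].
  - by case; rewrite eqxx.
have [_ /sO Ox] := mball _ xm; have [_ /sO Ox'] := mball _ x'm.
have c1 := f_mono Ox Ob; have := f_mono Ox' Ob.
rewrite x'E enormN edotNr => c2.
have xb0 : 0 < enorm (x - b) by rewrite enorm_gt0// subr_eq0.
have : edot (f x - f x') (x - b) <= delta * e * enorm (x - b).
  apply: (le_trans (edot_le _ _)).
  apply: ler_pM => //; rewrite ?normr_le_enorm//.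
  apply: (@le_trans _ _ (n.+1%:R * `|f x - f x'|)).
    by rewrite ler_wpM2r// ler_nat.
  by rewrite mulrC -ler_pdivlMr// ltW.
have -> : f x - f x' = (f x - f b) - (f x' - f b).
  by rewrite opprB addrA subrK.
rewrite edotDl edotNl => c3.
have c4 : 0 <= delta * enorm (f x' - f b) * enorm (x - b).
  by rewrite !mulr_ge0 ?enorm_ge0// ltW.
(* Adding [c1] and [c2] bounds the sum of both cone terms by [<f x - f x', x - b>]; the term of [x']
   is nonnegative and is dropped. *)
have : delta * enorm (f x - f b) * enorm (x - b) <= delta * e * enorm (x - b).
  by lra.
rewrite ler_pM2r// ler_pM2l// distrC.
exact: le_trans (normr_le_enorm _).
Qed.

(** The Cauchy criterion: [U] in a small ball about [b] gives a connected [U]&[Omega] on which [f]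
    oscillates little. It avoids [b], since [b] is not interior to the open set [Omega]. *)
Lemma cvg_boundary b : open Omega -> locally_connected_on_boundary Omega -> boundary Omega b ->
  cvg (f @ within Omega (nbhs b)).
Proof.
move=> oO lcO bO; have [clb nb] := bO.
have FF : ProperFilter (within Omega (nbhs b)) by exact: within_nbhs_proper.
apply/cauchy_cvgP; apply/cauchy_ballP => e e0.
have [M fM] := locally_bounded b.
have [r r0 osc] := small_oscillation delta_gt0 f_mono fM e0.
have [U [oU Ub Ur Uc]] := lcO b bO r r0.
have UO : \forall x \near within Omega (nbhs b), (U `&` Omega) x.
  by apply: filterS (open_nbhs_nbhs (conj oU Ub)) => x Ux Ox.
have fUO : \forall z \near f @ within Omega (nbhs b), (f @` (U `&` Omega)) z.
  by apply: filterS UO => x UOx; exists x.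
exists (f @` (U `&` Omega), f @` (U `&` Omega)); first by split.
move=> [_ _] /= [[x UOx <-] [y UOy <-]]; rewrite -ball_normE /=.
apply: (osc _ (connected_preconnected Uc)) => //.
- move=> z [/Ur xz _]; rewrite -ball_normE /= distrC.
  exact: le_lt_trans (normr_le_enorm _) xz.
- by move=> [_ Ob]; apply: nb; rewrite /interior; exact: open_nbhs_nbhs.
Qed.

(** If [f] is [e]-close to [g b] on [Omega] near [b], then so is [g c] for [c] in the closure near
    [b], being a limit of such values. Taking the interior of the neighbourhood makes the bound hold
    near [c] too. *)
Lemma within_closure_continuous (g : 'rV[R]_n -> 'rV[R]_n) :
  (forall b, closure Omega b -> f @ within Omega (nbhs b) --> g b) ->
  {within closure Omega, continuous g}.
Proof.
move=> fg; apply/subspace_continuousP => b clb.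
apply/cvgrPdist_le => e e0.
have /cvgrPdist_le/(_ _ e0) := fg b clb.
rewrite near_withinE => /nbhs_interior; rewrite /within /=; apply: filterS => c Nc clc.
have FF : ProperFilter (within Omega (nbhs c)) by exact: within_nbhs_proper.
apply: (@ler_cvg_filter R _ (within Omega (nbhs c)) (fun x => `|g b - f x|)
  (fun=> e)).
- exact: (cvg_norm (cvgB (cvg_cst (g b)) (fg c clc))).
- exact: cvg_cst.
- exact: Nc.
Qed.

(** The cone condition is closed, so it passes to the limit along the product filter, where the two
    points move independently. *)
Lemma delta_monotone_closure (g : 'rV[R]_n -> 'rV[R]_n) :
  (forall b, closure Omega b -> f @ within Omega (nbhs b) --> g b) ->
  delta_monotone delta (closure Omega) g.
Proof.
move=> fg x y clx cly.
have FF z : closure Omega z -> ProperFilter (within Omega (nbhs z)).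
  by move=> clz; exact: within_nbhs_proper.
have FFx := FF _ clx; have FFy := FF _ cly.
pose G := filter_prod (within Omega (nbhs x)) (within Omega (nbhs y)).
have G1 : fst @ G --> within Omega (nbhs x) by exact: cvg_fst.
have G2 : snd @ G --> within Omega (nbhs y) by exact: cvg_snd.
apply: (@cvg_in_cone _ _ _ G (fun p => f p.1 - f p.2) (fun p => p.1 - p.2)).
- exact: (cvgB (cvg_comp _ _ G1 (fg _ clx)) (cvg_comp _ _ G2 (fg _ cly))).
- apply: cvgB.
    exact: (cvg_trans G1 (cvg_within _)).
  exact: (cvg_trans G2 (cvg_within _)).
have A1 : \forall p \near G, Omega p.1 by apply: G1; exact: withinT.
have A2 : \forall p \near G, Omega p.2 by apply: G2; exact: withinT.
by apply: filterS2 A1 A2 => p Op1 Op2; exact: f_mono.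
Qed.

End Extension.

Theorem theorem7p3 (R : realType) (n : nat) (hn : (2 <= n)%N)
    (Omega : set 'rV[R]_n) (openOmega : open Omega)
    (lcOmega : locally_connected_on_boundary Omega)
    (delta : R) (delta_gt0 : 0 < delta)
    (f : 'rV[R]_n -> 'rV[R]_n) (f_mono : delta_monotone delta Omega f)
    (f_bdd : bounded_on_bounded Omega f) :
  exists g : 'rV[R]_n -> 'rV[R]_n,
    [/\ forall x, Omega x -> g x = f x,
        {within closure Omega, continuous g} &
        delta_monotone delta (closure Omega) g].
Proof.
(* Only the limits at boundary points matter; outside the closure the value is arbitrary. *)
pose g x := if `[< Omega x >] then f x else lim (f @ within Omega (nbhs x)).
have fg b : closure Omega b -> f @ within Omega (nbhs b) --> g b.
  move=> clb; rewrite /g; case: asboolP => Ob.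
    apply: cvg_trans (continuous_interior delta_gt0 f_mono f_bdd hn openOmega Ob).
    by apply: cvg_app; exact: cvg_within.
  apply: (cvg_boundary delta_gt0 f_mono f_bdd openOmega lcOmega).
  by split=> // /interior_subset.
exists g; split.
- by move=> x Ox; rewrite /g asboolT.
- exact: within_closure_continuous fg.
- exact: (delta_monotone_closure f_mono fg).
Qed.
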